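(* Assume that $p\in C^1(0,\infty)$ and $p'(\rho)>0$ for all $\rho>0$. Let an admissible piecewise constant fan subsolution have the same Riemann data as the classical planar contact discontinuity with $\rho_-=\rho_+=\rho_0$, $v_{-2}=v_{+2}=s$. Then the mismatch and rate coefficients of the fan relative to the classical contact satisfy $$\mathfrak I\ge0,\qquad \mathfrak E\le0.$$ Consequently, $$\mathfrak K=2(\mathfrak I-\mathfrak E)\ge2\mathfrak I\ge0,\qquad \mathfrak D=2\mathfrak I-\mathfrak E\ge0.$$ Moreover, $\mathfrak I>0$ whenever the fan density is not identically equal to $\rho_0$. If at least one of the interface entropy inequalities $[\mathcal F]_r-\nu_r[H]_r\le0$, $r=0,\dots,N$, is strict, then $$\mathfrak E<0,\qquad \mathfrak K>2\mathfrak I\ge0,\qquad \mathfrak D>0.$$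
   Context: The specific internal energy $e$ satisfies $p(\rho)=\rho^2e'(\rho)$ on $(0,\infty)$. Riemann data for the two-dimensional isentropic Euler equations $\partial_t\rho+\mathrm{div}(\rho v)=0$, $\partial_t(\rho v)+\mathrm{div}(\rho v\otimes v)+\nabla p(\rho)=0$: $(\rho_-,v_-)$ for $x_2<0$, $(\rho_+,v_+)$ for $x_2>0$, $v_\pm=(v_{\pm1},v_{\pm2})$. For a planar contact, $\rho_-=\rho_+=\rho_0>0$, $v_{-2}=v_{+2}=s$, $v_{-1}\ne v_{+1}$, and the classical contact solution is $(\rho_0,v_-)$ for $x_2<st$ and $(\rho_0,v_+)$ for $x_2>st$. Admissible piecewise constant fan subsolution: constants $\rho_i>0$, $v_i\in\mathbb R^2$, $u_i$ a trace-free symmetric $2\times2$ real matrix, $C_i>0$ ($i=1,\dots,N$), and speeds $\nu_0<\nu_1<\dots<\nu_N$. Put $P_-=\{t>0,\,x_2<\nu_0t\}$, $P_i=\{t>0,\,\nu_{i-1}t<x_2<\nu_it\}$, $P_+=\{t>0,\,x_2>\nu_Nt\}$, and let $\bar\rho,\bar v,\bar u,\bar C$ be the piecewise constant fields with values $\rho_i,v_i,u_i,C_i$ in $P_i$ and $\rho_\pm,\ v_\pm,\ v_\pm\otimes v_\pm-\tfrac12|v_\pm|^2\mathrm{Id},\ |v_\pm|^2$ in $P_\pm$. One requires $v_i\otimes v_i-u_i<\tfrac{C_i}{2}\mathrm{Id}$ for all $i$; the relaxed equations $\partial_t\bar\rho+\mathrm{div}(\bar\rho\bar v)=0$, $\partial_t(\bar\rho\bar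 v)+\mathrm{div}(\bar\rho\bar u)+\nabla(p(\bar\rho)+\tfrac12\bar\rho\bar C)=0$, equivalently the Rankine–Hugoniot relations at every interface; and the entropy inequalities below. Write $H_i=\tfrac12\rho_iC_i+\rho_ie(\rho_i)$, $\Lambda_i=\tfrac12\rho_iC_i-\rho_ie(\rho_i)$, $H_\pm=\tfrac12\rho_\pm|v_\pm|^2+\rho_\pm e(\rho_\pm)$, $\Lambda_\pm=\tfrac12\rho_\pm|v_\pm|^2-\rho_\pm e(\rho_\pm)$, $\mathcal J_\bullet=\rho_\bullet(v_\bullet)_2$, $\mathcal F_\bullet=(H_\bullet+p(\rho_\bullet))(v_\bullet)_2$ for $\bullet\in\{-,1,\dots,N,+\}$. For a quantity with values $f_-,f_1,\dots,f_N,f_+$ let $[f]_0=f_1-f_-$, $[f]_r=f_{r+1}-f_r$ ($1\le r\le N-1$), $[f]_N=f_+-f_N$. The mass Rankine–Hugoniot relations are $[\mathcal J]_r-\nu_r[\rho]_r=0$ and the entropy inequalities are $[\mathcal F]_r-\nu_r[H]_r\le0$, $r=0,\dots,N$. Coefficients: in $\xi=x_2/t$ let $H^{\mathrm{fan}}$ (resp. $\Lambda^{\mathrm{fan}}$) equal $H_-$, $H_i$, $H_+$ (resp. $\Lambda_-,\Lambda_i,\Lambda_+$) for $\xi<\nu_0$, $\nu_{i-1}<\xi<\nu_i$, $\xi>\nu_N$, and let $H^{\mathrm c}$ (resp. $\Lambda^{\mathrm c}$) equal $H_-$ (resp. $\Lambda_-$) for $\xi<s$ and $H_+$ (resp. $\Lambda_+$)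 for $\xi>s$. Then $\mathfrak E=\int_{\mathbb R}[H^{\mathrm{fan}}-H^{\mathrm c}]\,d\xi$ and $\mathfrak D=\int_{\mathbb R}[\Lambda^{\mathrm c}-\Lambda^{\mathrm{fan}}]\,d\xi$. With reference partition $\sigma_0=-\infty,\ \sigma_1=s,\ \sigma_2=\infty$, reference densities $\rho_1^{\mathrm{ref}}=\rho_2^{\mathrm{ref}}=\rho_0$, $C_1^{\mathrm{ref}}=|v_-|^2$, $C_2^{\mathrm{ref}}=|v_+|^2$ and $\omega_{ij}=\max\{0,\min\{\nu_i,\sigma_j\}-\max\{\nu_{i-1},\sigma_{j-1}\}\}$, $$\mathfrak K=\sum_{i=1}^N\sum_{j=1}^2\omega_{ij}(\rho_0C_j^{\mathrm{ref}}-\rho_iC_i),\qquad \mathfrak I=\sum_{i=1}^N\sum_{j=1}^2\omega_{ij}[\rho_ie(\rho_i)-\rho_0e(\rho_0)].$$ Standing assumption for these coefficients: fan and reference agree on the exterior regions, i.e. $\nu_0\le s\le\nu_N$. *)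

(* Defs.v *)
From HB Require Import structures.
From mathcomp Require Import all_boot all_order all_algebra.
From mathcomp Require Import all_classical all_reals all_analysis.
Import Order.TTheory GRing.Theory Num.Theory.
Import numFieldNormedType.Exports.

Set Implicit Arguments.
Unset Strict Implicit.
Unset Printing Implicit Defensive.

Local Open Scope classical_set_scope.
Local Open Scope ring_scope.

(* Vectors of R^2 are row vectors; the components v_1 and v_2 are at
   the indices 0 and 1 of 'I_2. *)

Definition sqnorm (R : realType) (v : 'rV[R]_2) : R := \sum_(k < 2) v 0 k ^+ 2.

Definition tensor (R : realType) (v : 'rV[R]_2) : 'M[R]_2 := v^T *m v.

Definition mxlt (R : realType) (A B : 'M[R]_2) : Prop :=
  forall x : 'cV[R]_2, x != 0 -> 0 < (x^T *m (B - A) *m x) 0 0.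

Definition C1_pos (R : realType) (f : R -> R) : Prop :=
  (forall r, 0 < r -> derivable f r 1) /\
  (forall r, 0 < r -> {for r, continuous (derive1 f)}).

Definition internal_energy (R : realType) (p e : R -> R) : Prop :=
  forall r, 0 < r -> derivable e r 1 /\ p r = r ^+ 2 * derive1 e r.

Record riemann_data (R : realType) := RiemannData {
  densL : R; velL : 'rV[R]_2;
  densR : R; velR : 'rV[R]_2 }.

(* The values (rho, v, u, C) of a subsolution on one sector. *)
Record state (R : realType) := State {
  dens : R; vel : 'rV[R]_2; stress : 'M[R]_2; ckin : R }.

Definition outer_state (R : realType) (r : R) (v : 'rV[R]_2) : state R :=
  State r v (tensor v - (sqnorm v / 2)%:M) (sqnorm v).

(* Only [speed r] for 0 <= r <= nsect and
   [sector i] for 1 <= i <= nsect are ever used. *)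
Record fan (R : realType) := Fan {
  nsect : nat;
  speed : nat -> R;
  sector : nat -> state R }.

Section Fan.
Variables (R : realType) (p e : R -> R) (D : riemann_data R) (F : fan R).

Let N := nsect F.
Let nu := speed F.

(* Regions from left to right: 0 is P_-, i is P_i, N + 1 is P_+; hence
   interface r separates regions r and r + 1. *)
Definition region (k : nat) : state R :=
  if k == 0%N then outer_state (densL D) (velL D)
  else if (k <= N)%N then sector F k
  else outer_state (densR D) (velR D).

Definition jump (f : state R -> R) (r : nat) : R :=
  f (region r.+1) - f (region r).

Definition energy (S : state R) : R :=
  dens S * ckin S / 2 + dens S * e (dens S).

Definition lagrangian (S : state R) : R :=
  dens S * ckin S / 2 - dens S * e (dens S).

Definition mass_flux (S : state R) : R := dens S * vel S 0 1.

Definition energy_flux (S : state R) : R :=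
  (energy S + p (dens S)) * vel S 0 1.

Definition momentum (k : 'I_2) (S : state R) : R := dens S * vel S 0 k.

(* x_2-component of the flux of the k-th relaxed momentum equation. *)
Definition momentum_flux (k : 'I_2) (S : state R) : R :=
  (dens S *: stress S + (p (dens S) + dens S * ckin S / 2)%:M) k 1.

(* The fields depend on x_2 / t only, so that the relaxed equations amount to
   the Rankine-Hugoniot relations across each interface x_2 = nu_r t. *)
Definition rankine_hugoniot (r : nat) : Prop :=
  jump mass_flux r - nu r * jump (@dens R) r = 0 /\
  forall k, jump (momentum_flux k) r - nu r * jump (momentum k) r = 0.

Definition entropy_production (r : nat) : R :=
  jump energy_flux r - nu r * jump energy r.

Definition admissible_fan_subsolution : Prop :=
  (forall r, (r < N)%N -> nu r < nu r.+1) /\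
  (forall i, (1 <= i <= N)%N ->
     [/\ 0 < dens (sector F i), 0 < ckin (sector F i),
         (stress (sector F i))^T = stress (sector F i),
         \tr (stress (sector F i)) = 0 &
         mxlt (tensor (vel (sector F i)) - stress (sector F i))
              (ckin (sector F i) / 2)%:M]) /\
  (forall r, (r <= N)%N -> rankine_hugoniot r) /\
  (forall r, (r <= N)%N -> entropy_production r <= 0).

Definition planar_contact (rho0 s : R) : Prop :=
  [/\ 0 < rho0, densL D = rho0 /\ densR D = rho0,
      velL D 0 1 = s /\ velR D 0 1 = s & velL D 0 0 != velR D 0 0].

(* Self-similar profiles in xi = x_2 / t; their value at the finitely many
   interfaces is 0, which is irrelevant for the integrals below. *)
Definition fan_profile (f : state R -> R) (xi : R) : R :=
  f (region 0) * \1_(`]-oo, nu 0%N[) xi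
  + \sum_(1 <= i < N.+1) f (region i) * \1_(`]nu i.-1, nu i[) xi
  + f (region N.+1) * \1_(`]nu N, +oo[) xi.

Definition contact_profile (s : R) (f : state R -> R) (xi : R) : R :=
  f (outer_state (densL D) (velL D)) * \1_(`]-oo, s[) xi
  + f (outer_state (densR D) (velR D)) * \1_(`]s, +oo[) xi.

Definition Ecoef (s : R) : R :=
  Rintegral (@lebesgue_measure R) setT
    (fun xi => fan_profile energy xi - contact_profile s energy xi).

Definition Dcoef (s : R) : R :=
  Rintegral (@lebesgue_measure R) setT
    (fun xi => contact_profile s lagrangian xi - fan_profile lagrangian xi).

Definition refpart (s : R) (j : nat) : \bar R :=
  if j == 0%N then -oo%E else if j == 1%N then s%:E else +oo%E.

Definition Cref (j : nat) : R :=
  if j == 1%N then sqnorm (velL D) else sqnorm (velR D).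

Definition overlap (s : R) (i j : nat) : R :=
  fine (maxe 0 (mine (nu i)%:E (refpart s j)
                - maxe (nu i.-1)%:E (refpart s j.-1)))%E.

Definition Kcoef (rho0 s : R) : R :=
  \sum_(1 <= i < N.+1) \sum_(1 <= j < 3)
    overlap s i j * (rho0 * Cref j - dens (sector F i) * ckin (sector F i)).

Definition Icoef (rho0 s : R) : R :=
  \sum_(1 <= i < N.+1) \sum_(1 <= j < 3)
    overlap s i j
      * (dens (sector F i) * e (dens (sector F i)) - rho0 * e rho0).

End Fan.

(* Main.v *)
Require Import Defs.
From mathcomp Require Import all_boot all_order all_algebra.
From mathcomp Require Import all_classical all_reals all_analysis.
From mathcomp Require Import ring lra.
Import Order.TTheory GRing.Theory Num.Theory.
Import numFieldNormedType.Exports.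
Local Open Scope classical_set_scope.
Local Open Scope ring_scope.

(** Every coefficient compares the fan profile of some quantity [f] of the
    state with its contact profile.  Both profiles agree outside the fan, so
    the integral over [xi] of their difference is a finite sum [excess f],
    linear in [f]; the overlap weights of [K] and [I] compute the same sum,
    the contact being constant on each part of the reference partition.  With
    [E = excess energy], [I = excess (rho e(rho))], [K = - excess (rho C)] and
    [D = - excess lagrangian], the identities [K = 2 (I - E)] and
    [D = 2 I - E] follow from the definitions of the energy and of the
    lagrangian by linearity.

    The sign of [E] is a global conservation argument.  Summation by parts
    turns [excess f] into the sum over the interfaces of
    [jump flux - nu * jump f], as soon as [f] is transported at speed [s]
    across the contact, i.e. the total jump of [flux] is [s] times that of [f]
    ([excess_balance]).  Since the pressure and the normal velocity are the
    same on both sides of the contact, this holds for the energy and the mass.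
    Thus [E] is the total entropy production, which is nonpositive, and
    negative if one interface is strict, while the Rankine-Hugoniot relations
    give [excess rho = 0].

    The sign of [I] is Jensen's inequality: the fan and the contact have the
    same mass on the fan, the density of the contact is constant there, and
    [rho e(rho)] is strictly convex since its second derivative is
    [p'(rho) / rho].  Subtracting the tangent line at [rho0], which
    contributes nothing to the excess as the mass balances, writes [I] as a sum
    of nonnegative convexity defects ([convex_excess_ge0]). *)

(** * Strict convexity of the internal energy density *)

Lemma positive_MVT {R : realType} (g dg : R -> R) (x y : R) :
  (forall r : R, 0 < r -> is_derive r (1 : R) g (dg r)) -> 0 < x -> x < y ->
  exists2 c, x < c < y & g y - g x = dg c * (y - x).
Proof.
move=> g_der x_gt0 xy.
have der_xy (r : R) : x <= r -> is_derive r (1 : R) g (dg r).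
  by move=> xr; apply: g_der; exact: lt_le_trans xr.
have [||c] := @MVT R g dg x y xy.
- by move=> r; rewrite in_itv /= => /andP[/ltW xr _]; exact: der_xy.
- apply: derivable_within_continuous => r; rewrite in_itv /= => /andP[xr _].
  by have [] := der_xy r xr.
by rewrite in_itv /= => c_xy ->; exists c.
Qed.

(** Comparing the slope of the chord, which is [dg c] for some [c] strictly
    between [a] and [x], with [dg a]: [dg] increases strictly. *)
Lemma strict_tangent_line {R : realType} (g dg ddg : R -> R) (a x : R) :
  (forall r : R, 0 < r -> is_derive r (1 : R) g (dg r)) ->
  (forall r : R, 0 < r -> is_derive r (1 : R) dg (ddg r)) ->
  (forall r, 0 < r -> 0 < ddg r) ->
  0 < a -> 0 < x -> x != a -> g a + dg a * (x - a) < g x.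
Proof.
move=> g_der dg_der ddg_gt0 a_gt0 x_gt0.
have dg_incr r q : 0 < r -> r < q -> dg r < dg q.
  move=> r_gt0 rq.
  have [c /andP[rc _] Ec] := positive_MVT dg ddg r q dg_der r_gt0 rq.
  by rewrite -subr_gt0 Ec mulr_gt0 ?subr_gt0// ddg_gt0// (lt_trans r_gt0).
rewrite neq_lt => /orP[xa|ax].
  have [c /andP[xc ca] Ec] := positive_MVT g dg x a g_der x_gt0 xa.
  have := dg_incr c a (lt_trans x_gt0 xc) ca.
  by move: Ec; nra.
have [c /andP[ac cx] Ec] := positive_MVT g dg a x g_der a_gt0 ax.
have := dg_incr a c a_gt0 ac.
by move: Ec; nra.
Qed.

(** With [p = r^2 e'], the derivative of [r e(r)] is [e + p / r] and its
    second derivative simplifies to [p' / r]. *)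
Lemma internal_energy_density_tangent {R : realType} (p e : R -> R) (a x : R) :
  C1_pos p -> (forall r, 0 < r -> 0 < derive1 p r) -> internal_energy p e ->
  0 < a -> 0 < x -> x != a ->
  a * e a + (e a + p a / a) * (x - a) < x * e x.
Proof.
move=> [p_der _] dp_gt0 pe.
apply: (@strict_tangent_line R (fun r => r * e r) (fun r => e r + p r / r)
          (fun r => derive1 p r / r)) => r r_gt0.
- have [e_der p_eq] := pe r r_gt0.
  have de : is_derive r (1 : R) e (derive1 e r).
    by rewrite derive1E; exact: derivableP.
  apply: is_derive_eq; rewrite p_eq /GRing.scale /=.
  by field; lra.
- have [e_der p_eq] := pe r r_gt0.
  have de : is_derive r (1 : R) e (derive1 e r).
    by rewrite derive1E; exact: derivableP.
  have dp : is_derive r (1 : R) p (derive1 p r).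
    by rewrite derive1E; apply: derivableP; exact: p_der.
  have r_neq0 : r != 0 by rewrite gt_eqF.
  have dV : is_derive r (1 : R) (fun q => q^-1) (- (r ^+ 2)^-1).
    have := @is_deriveV R id r 1 1 r_neq0 (is_derive_id _ _).
    by move=> H; apply: (is_derive_eq H); rewrite /GRing.scale /= mulr1.
  apply: is_derive_eq; rewrite p_eq /GRing.scale /=.
  by field; lra.
- by rewrite divr_gt0// dp_gt0.
Qed.

(** * Excess of a fan over the contact *)

(** The value of the integral over [xi] of the fan profile of [f] minus its
    contact profile: on [nu_0, s] and [s, nu_N] the contact takes the values
    of the two outer regions. *)
Definition excess {R : realType} (D : riemann_data R) (F : fan R) (s : R)
    (f : state R -> R) : R :=
  \sum_(0 <= i < nsect F)
    f (region D F i.+1) * (speed F i.+1 - speed F i)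
  - f (region D F 0) * (s - speed F 0%N)
  - f (region D F (nsect F).+1) * (speed F (nsect F) - s).

Lemma excess_linear {R : realType} (D : riemann_data R) (F : fan R) (s : R)
    (a b : R) (f g : state R -> R) :
  excess D F s (fun S => a * f S + b * g S)
  = a * excess D F s f + b * excess D F s g.
Proof.
have -> : excess D F s (fun S => a * f S + b * g S) =
    \sum_(0 <= i < nsect F)
      (a * (f (region D F i.+1) * (speed F i.+1 - speed F i))
       + b * (g (region D F i.+1) * (speed F i.+1 - speed F i)))
    - (a * f (region D F 0) + b * g (region D F 0)) * (s - speed F 0%N)
    - (a * f (region D F (nsect F).+1) + b * g (region D F (nsect F).+1))
      * (speed F (nsect F) - s).
  rewrite /excess; congr (_ - _ - _); apply: eq_bigr => i _; ring.
rewrite big_split /= -!mulr_sumr /excess.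
ring.
Qed.

Lemma summation_by_parts {R : realType} (a b : nat -> R) (n : nat) :
  \sum_(0 <= r < n.+1) a r * (b r.+1 - b r) =
  a n * b n.+1 - a 0%N * b 0%N - \sum_(0 <= i < n) b i.+1 * (a i.+1 - a i).
Proof.
elim: n => [|n IH]; first by rewrite big_nat1 big_geq //; ring.
by rewrite big_nat_recr //= IH [in RHS]big_nat_recr //=; ring.
Qed.

Lemma excess_jumps {R : realType} (D : riemann_data R) (F : fan R) (s : R)
    (f : state R -> R) :
  excess D F s f =
  s * (f (region D F (nsect F).+1) - f (region D F 0))
  - \sum_(0 <= r < (nsect F).+1) speed F r * jump D F f r.
Proof.
rewrite /jump (summation_by_parts (speed F) (fun k => f (region D F k))).
by rewrite /excess; ring.
Qed.

(** The telescoping sum of the jumps of [flux] absorbs the term carrying the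
    contact speed, so that only the defects of the jump relations remain. *)
Lemma excess_balance {R : realType} (D : riemann_data R) (F : fan R) (s : R)
    (f flux : state R -> R) :
  flux (region D F (nsect F).+1) - flux (region D F 0) =
    s * (f (region D F (nsect F).+1) - f (region D F 0)) ->
  excess D F s f =
  \sum_(0 <= r < (nsect F).+1) (jump D F flux r - speed F r * jump D F f r).
Proof.
move=> fluxE; rewrite excess_jumps -fluxE sumrB; congr (_ - _).
by rewrite /jump (telescope_sumr (fun k => flux (region D F k))).
Qed.

(** [Rintegral] is additive on integrable functions only, hence the
    integrability is carried along with the value. *)
Definition has_integral {R : realType} (f : R -> R) (v : R) : Prop :=
  (@lebesgue_measure R).-integrable setT (EFin \o f) /\
  Rintegral (@lebesgue_measure R) setT f = v.

Lemma has_integralD {R : realType} (f g : R -> R) (v w : R) :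
  has_integral f v -> has_integral g w ->
  has_integral (fun x => f x + g x) (v + w).
Proof.
move=> [f_int <-] [g_int <-]; split; last by rewrite RintegralD.
exact: (integrableD measurableT f_int g_int).
Qed.

Lemma has_integralZ {R : realType} (c : R) (f : R -> R) (v : R) :
  has_integral f v -> has_integral (fun x => c * f x) (c * v).
Proof.
move=> [f_int <-]; split; last by rewrite RintegralZl.
exact: (integrableZl measurableT c f_int).
Qed.

Lemma has_integral_itv {R : realType} (b0 b1 : bool) (a b : R) :
  a <= b ->
  has_integral (\1_[set` Interval (BSide b0 a) (BSide b1 b)] : R -> R) (b - a).
Proof.
move=> ab; split; first exact: (integrable_indic_itv a b b0 b1).
rewrite /Rintegral (integral_indic lebesgue_measure measurableT (measurable_itv _)) setIT.
rewrite [X in fine X](lebesgue_measure_itv (Interval (BSide b0 a) (BSide b1 b))) /= lte_fin.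
by move: ab; rewrite le_eqVlt => /predU1P[->|->] //; rewrite ltxx subrr.
Qed.

Lemma has_integral_sum {R : realType} (n : nat) (f : nat -> R -> R)
    (v : nat -> R) :
  (forall i, (i < n)%N -> has_integral (f i) (v i)) ->
  has_integral (fun x => \sum_(0 <= i < n) f i x) (\sum_(0 <= i < n) v i).
Proof.
elim: n => [_|n IH fv].
  have := @has_integralZ R 0 _ _ (has_integral_itv true true 0 0 (lexx _)).
  rewrite mul0r big_nil; congr has_integral; apply/funext => x.
  by rewrite big_nil mul0r.
rewrite big_nat_recr //=.
under eq_fun do rewrite big_nat_recr //=.
apply: has_integralD; last exact: fv.
by apply: IH => i i_n; apply: fv; exact: ltnW.
Qed.

(** The indicators of the unbounded outer sectors are not integrable; they
    cancel because [nu_0 <= s <= nu_N], which leaves indicators of bounded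
    intervals. *)
Lemma has_integral_profile {R : realType} (D : riemann_data R) (F : fan R)
    (s : R) (f : state R -> R) :
  (forall r, (r < nsect F)%N -> speed F r < speed F r.+1) ->
  speed F 0%N <= s <= speed F (nsect F) ->
  has_integral (fun xi => fan_profile D F f xi - contact_profile D s f xi)
    (excess D F s f).
Proof.
move=> nu_incr /andP[nu0_s s_nuN].
have -> : (fun xi => fan_profile D F f xi - contact_profile D s f xi) =
  (fun xi => \sum_(0 <= i < nsect F)
      f (region D F i.+1) * \1_(`]speed F i, speed F i.+1[) xi
    + - f (region D F 0) * \1_(`[speed F 0%N, s[) xi
    + - f (region D F (nsect F).+1) * \1_(`]s, speed F (nsect F)]) xi).
  apply/funext => xi; rewrite /fan_profile /contact_profile big_add1 /=.
  have -> : f (outer_state (densL D) (velL D)) = f (region D F 0) by [].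
  have -> : f (outer_state (densR D) (velR D)) = f (region D F (nsect F).+1).
    by rewrite /region /= ltnn.
  (* The endpoints of the bounded intervals are chosen so that both
     decompositions hold at every point, not only almost everywhere. *)
  have -> : (\1_(`]-oo, s[) xi : R) =
      \1_(`]-oo, speed F 0%N[) xi + \1_(`[speed F 0%N, s[) xi.
    rewrite !indicE !mem_setE !in_itv /=.
    have [h|h] := ltP xi (speed F 0%N); last by rewrite add0r.
    by rewrite (lt_le_trans h nu0_s) addr0.
  have -> : (\1_(`]s, +oo[) xi : R) =
      \1_(`]speed F (nsect F), +oo[) xi + \1_(`]s, speed F (nsect F)]) xi.
    rewrite !indicE !mem_setE !in_itv /= !andbT.
    have [h|h] := leP xi (speed F (nsect F)); first by rewrite add0r andbT.
    by rewrite (le_lt_trans s_nuN h) addr0.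
  by ring.
have -> : excess D F s f =
  \sum_(0 <= i < nsect F) f (region D F i.+1) * (speed F i.+1 - speed F i)
  + - f (region D F 0) * (s - speed F 0%N)
  + - f (region D F (nsect F).+1) * (speed F (nsect F) - s).
  by rewrite /excess !mulNr.
apply: has_integralD; first apply: has_integralD.
- apply: has_integral_sum => i i_n; apply/has_integralZ/has_integral_itv.
  by apply/ltW/nu_incr.
- exact/has_integralZ/has_integral_itv.
- exact/has_integralZ/has_integral_itv.
Qed.

(** This form telescopes when summed over the sectors. *)
Lemma overlap1 {R : realType} (F : fan R) (s : R) (i : nat) :
  speed F i < speed F i.+1 ->
  overlap F s i.+1 1 = Num.min (speed F i.+1) s - Num.min (speed F i) s.
Proof.
move=> nu_incr; rewrite /overlap /refpart /=.
rewrite -EFin_min -EFinD -EFin_max /=.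
rewrite /Num.max /Num.min.
by case: (ltP (speed F i.+1) s) => ?; case: (ltP (speed F i) s) => ?;
  case: ltP => ?; lra.
Qed.

Lemma overlap2 {R : realType} (F : fan R) (s : R) (i : nat) :
  speed F i < speed F i.+1 ->
  overlap F s i.+1 2 = Num.max (speed F i.+1) s - Num.max (speed F i) s.
Proof.
move=> nu_incr; rewrite /overlap /refpart /=.
rewrite miney -EFin_max -EFinB -EFin_max /=.
rewrite /Num.max /Num.min.
by case: (ltP (speed F i.+1) s) => ?; case: (ltP (speed F i) s) => ?;
  case: ltP => ?; lra.
Qed.

(** On sector [i] the two overlaps add up to [nu_i - nu_(i-1)], because
    [min (x, s) + max (x, s) = x + s]; summed over the sectors they telescope
    to [s - nu_0] and [nu_N - s]. *)
Lemma sum_overlap {R : realType} (D : riemann_data R) (F : fan R) (s : R)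
    (f : state R -> R) (c : nat -> R) :
  (forall r, (r < nsect F)%N -> speed F r < speed F r.+1) ->
  speed F 0%N <= s <= speed F (nsect F) ->
  c 1%N = f (region D F 0) -> c 2%N = f (region D F (nsect F).+1) ->
  \sum_(1 <= i < (nsect F).+1) \sum_(1 <= j < 3)
    overlap F s i j * (f (sector F i) - c j) = excess D F s f.
Proof.
move=> nu_incr /andP[nu0_s s_nuN] c1 c2.
rewrite big_add1 /=.
pose w i := f (region D F i.+1) * (speed F i.+1 - speed F i).
pose m i := Num.min (speed F i) s.
pose M i := Num.max (speed F i) s.
have mM i : m i + M i = speed F i + s by rewrite /m /M addr_min_max.
transitivity (\sum_(0 <= i < nsect F)
    (w i - ((m i.+1 - m i) * c 1%N + (M i.+1 - M i) * c 2%N))).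
  rewrite !big_nat; apply: eq_bigr => i /= i_n.
  rewrite big_nat_recr // big_nat1 overlap1 ?overlap2 ?nu_incr //.
  have -> : sector F i.+1 = region D F i.+1 by rewrite /region /= i_n.
  rewrite -/(m i) -/(m i.+1) -/(M i) -/(M i.+1) /w.
  have -> : speed F i.+1 - speed F i = (m i.+1 - m i) + (M i.+1 - M i).
    have := mM i; have := mM i.+1; lra.
  rewrite /=; ring.
rewrite sumrB big_split /= -!mulr_suml !telescope_sumr //.
rewrite /excess -/(w _) c1 c2 /m /M.
rewrite (min_idPl nu0_s) (max_idPr nu0_s) (min_idPr s_nuN) (max_idPl s_nuN).
by rewrite opprD addrA ![(_ - _) * f _]mulrC.
Qed.

(** * Sign of the excess of a convex function of the density *)

(** Jensen's inequality: the excess of [G] is unchanged when the tangent line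
    of slope [a] at [rho0] is subtracted from [G], for the densities balance;
    what is left in each sector is a convexity defect weighted by the sector
    width. *)
Lemma convex_excess_ge0 {R : realType} (D : riemann_data R) (F : fan R)
    (s rho0 a : R) (G : R -> R) :
  densL D = rho0 -> densR D = rho0 ->
  (forall r, (r < nsect F)%N -> speed F r < speed F r.+1) ->
  (forall i, (1 <= i <= nsect F)%N -> 0 < dens (sector F i)) ->
  (forall x, 0 < x -> x != rho0 -> G rho0 + a * (x - rho0) < G x) ->
  excess D F s (@dens R) = 0 ->
  0 <= excess D F s (fun S => G (dens S)) /\
  (~ (forall k, (k <= (nsect F).+1)%N -> dens (region D F k) = rho0) ->
   0 < excess D F s (fun S => G (dens S))).
Proof.
move=> rhoL rhoR nu_incr rho_gt0 tangent mass.
pose rho i := dens (region D F i).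
pose len i := speed F i.+1 - speed F i.
pose defect i := (G (rho i.+1) - G rho0 - a * (rho i.+1 - rho0)) * len i.
have rho_out : rho 0%N = rho0 /\ rho (nsect F).+1 = rho0.
  by rewrite /rho /region /= ltnn.
have -> : excess D F s (fun S => G (dens S)) = \sum_(0 <= i < nsect F) defect i.
  suff -> : excess D F s (fun S => G (dens S)) =
      \sum_(0 <= i < nsect F) defect i + a * excess D F s (@dens R).
    by rewrite mass mulr0 addr0.
  have -> : \sum_(0 <= i < nsect F) defect i =
    \sum_(0 <= i < nsect F) (G (rho i.+1) * len i)
    - a * \sum_(0 <= i < nsect F) (rho i.+1 * len i)
    - (G rho0 - a * rho0) * (speed F (nsect F) - speed F 0%N).
    rewrite -(telescope_sumr (speed F)) // !mulr_sumr -!sumrB.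
    by apply: eq_bigr => i _; rewrite /defect /len; ring.
  rewrite /excess -/(rho _) -/(rho _) (proj1 rho_out) (proj2 rho_out).
  by rewrite /rho /len; ring.
have rhoS_gt0 i : (i < nsect F)%N -> 0 < rho i.+1.
  by move=> i_n; rewrite /rho /region /= i_n; apply: rho_gt0.
have defect_gt0 i : (i < nsect F)%N -> rho i.+1 != rho0 -> 0 < defect i.
  move=> i_n rho_neq; rewrite mulr_gt0 ?subr_gt0 ?nu_incr //.
  by have := tangent _ (rhoS_gt0 i i_n) rho_neq; lra.
have defect_ge0 i : (i < nsect F)%N -> 0 <= defect i.
  move=> i_n; have [rhoE|/(defect_gt0 i i_n)/ltW//] := eqVneq (rho i.+1) rho0.
  by rewrite /defect rhoE !subrr mulr0 subrr mul0r.
split; first by rewrite big_nat; apply: sumr_ge0 => i /= /defect_ge0.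
move=> not_const; rewrite big_mkord.
have defect_ord (i : 'I_(nsect F)) : 0 <= defect i by apply: defect_ge0.
rewrite lt_neqAle sumr_ge0 ?andbT; last by move=> i _; exact: defect_ord.
apply/eqP => sum0; apply: not_const => -[_|k]; first by case: rho_out.
rewrite ltnS leq_eqVlt => /predU1P[->|k_n]; first by case: rho_out.
apply/eqP/negPn/negP => rho_neq.
have /eqP := esym sum0; rewrite psumr_eq0 => [|i _]; last exact: defect_ord.
move=> /allP/(_ (Ordinal k_n) (mem_index_enum _)) /=.
by rewrite gt_eqF // defect_gt0.
Qed.

Theorem theorem4p3 (R : realType) (p e : R -> R) (D : riemann_data R)
    (F : fan R) (rho0 s : R)
    (p_C1 : C1_pos p)
    (p_incr : forall r : R, 0 < r -> 0 < derive1 p r)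
    (pe : internal_energy p e)
    (contact : planar_contact D rho0 s)
    (subsol : admissible_fan_subsolution p e D F)
    (exterior : speed F 0%N <= s <= speed F (nsect F)) :
  (0 <= Icoef e F rho0 s /\ Ecoef e D F s <= 0) /\
  (Kcoef D F rho0 s = 2 * (Icoef e F rho0 s - Ecoef e D F s) /\
   2 * (Icoef e F rho0 s - Ecoef e D F s) >= 2 * Icoef e F rho0 s /\
   2 * Icoef e F rho0 s >= 0) /\
  (Dcoef e D F s = 2 * Icoef e F rho0 s - Ecoef e D F s /\
   2 * Icoef e F rho0 s - Ecoef e D F s >= 0) /\
  (~ (forall k : nat, (k <= (nsect F).+1)%N -> dens (region D F k) = rho0) ->
   0 < Icoef e F rho0 s) /\
  ((exists2 r : nat, (r <= nsect F)%N & entropy_production p e D F r < 0) ->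
   Ecoef e D F s < 0 /\
   (Kcoef D F rho0 s > 2 * Icoef e F rho0 s /\ 2 * Icoef e F rho0 s >= 0) /\
   Dcoef e D F s > 0).
Proof.
have [rho0_gt0 [rhoL rhoR] [vL vR] _] := contact.
have [nu_incr [sectorP [RH entropy]]] := subsol.
have regionR : region D F (nsect F).+1 = outer_state (densR D) (velR D).
  by rewrite /region /= ltnn.
pose internal (S : state R) := dens S * e (dens S).
pose kinetic (S : state R) := dens S * ckin S.
have EE : Ecoef e D F s = excess D F s (energy e).
  by have [_ ] := has_integral_profile D F s (energy e) nu_incr exterior.
have EK : Kcoef D F rho0 s = - excess D F s kinetic.
  rewrite -(sum_overlap D F s kinetic (fun j => rho0 * Cref D j) nu_incr exterior).
  - rewrite /Kcoef -sumrN; apply: eq_bigr => i _; rewrite -sumrN.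
    by apply: eq_bigr => j _; rewrite /kinetic; ring.
  - by rewrite /kinetic /= rhoL.
  - by rewrite regionR /kinetic /= rhoR.
have EI : Icoef e F rho0 s = excess D F s internal.
  rewrite -(sum_overlap D F s internal (fun=> rho0 * e rho0) nu_incr exterior) //.
  - by rewrite /internal /= rhoL.
  - by rewrite regionR /internal /= rhoR.
have ED : Dcoef e D F s = - excess D F s (lagrangian e).
  have := has_integralZ (-1) _ _
    (has_integral_profile D F s (lagrangian e) nu_incr exterior).
  rewrite mulN1r => -[_ <-].
  congr Rintegral.
  by apply/funext => xi; rewrite mulN1r opprB.
have Eenergy : excess D F s (energy e) =
    2^-1 * excess D F s kinetic + excess D F s internal.
  rewrite -[X in _ + X]mul1r -excess_linear; congr excess; apply/funext => S.
  by rewrite /energy /kinetic /internal; field.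
have Elagr : excess D F s (lagrangian e) =
    2^-1 * excess D F s kinetic - excess D F s internal.
  rewrite -[X in _ - X]mul1r -mulNr -excess_linear; congr excess; apply/funext => S.
  by rewrite /lagrangian /kinetic /internal; field.
have mass0 : excess D F s (@dens R) = 0.
  rewrite (excess_balance D F s (@dens R) (@mass_flux R)); last first.
    by rewrite regionR /mass_flux /= rhoL rhoR vL vR; ring.
  by rewrite big_nat big1 // => r /= r_n; have [] := RH r r_n.
have Eprod : excess D F s (energy e) =
    \sum_(0 <= r < (nsect F).+1) entropy_production p e D F r.
  apply: excess_balance; rewrite regionR /energy_flux /= rhoL rhoR vL vR.
  by rewrite /energy /=; ring.
(* The slope is the derivative of [r e(r)] at [rho0]. *)
have [I_ge0 I_gt0] := convex_excess_ge0 D F s rho0 (e rho0 + p rho0 / rho0)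
  (fun r => r * e r) rhoL rhoR nu_incr
  (fun i i_n => let: And5 rho_gt0 _ _ _ _ := sectorP i i_n in rho_gt0)
  (fun x x_gt0 x_neq => internal_energy_density_tangent p e rho0 x p_C1 p_incr
     pe rho0_gt0 x_gt0 x_neq) mass0.
rewrite -[excess _ _ _ _]EI in I_ge0 I_gt0.
have E_le0 : Ecoef e D F s <= 0.
  by rewrite EE Eprod big_nat; apply: sumr_le0 => r /=; exact: entropy.
have EKI : Kcoef D F rho0 s = 2 * (Icoef e F rho0 s - Ecoef e D F s) by lra.
have EDI : Dcoef e D F s = 2 * Icoef e F rho0 s - Ecoef e D F s by lra.
split; first by split.
split; first by split=> //; lra.
split; first by split=> //; lra.
split=> //.
move=> [r r_n prod_lt0].
have E_lt0 : Ecoef e D F s < 0.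
  rewrite EE Eprod big_mkord (bigD1 (Ordinal (r_n : (r < (nsect F).+1)%N))) //=.
  rewrite -[ltRHS]addr0 ltr_leD // sumr_le0 // => q _.
  by apply: entropy; rewrite -ltnS.
by split=> //; split; lra.
Qed.
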